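(* Consider $d=1$ and steps bounded by $B$. Let $\hat{\pi}$ be an environment kernel with $\hat\pi(\cdot,1)>0$ $\mathbb{P}$-a.s. and $E_0^{\hat\pi}[t_1]<\infty$, where $t_1:=\inf\{k\ge0:X_k\ge1\}$. Then: (a) for $\mathbb{P}$-a.e. $\omega$ the limit $\phi(\omega):=\lim_{x\to-\infty}E_x^{\hat\pi,\omega}\left[\sum_{k=0}^\infty \mathbf{1}_{X_k=0}\right]$ exists and satisfies $\phi(\omega)>0$; (b) $\phi\in L^1(\mathbb{P})$; (c) the probability measure $\mathbb{Q}$ with $\mathrm{d}\mathbb{Q}=\phi\,\mathrm{d}\mathbb{P}/\|\phi\|_{L^1(\mathbb{P})}$ is $\hat\pi$-invariant, i.e. $\sum_{z\in\mathcal{R}}\phi(T_{-z}\omega)\hat\pi(T_{-z}\omega,z)=\phi(\omega)$ for $\mathbb{P}$-a.e. $\omega$.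
   Context: Let $B\ge1$, $\mathcal{R}:=\{z\in\mathbb{Z}:0<|z|\le B\}$. An environment is $\omega=(\omega_x)_{x\in\mathbb{Z}}$ with $\omega_x=(\pi(x,x+z))_{z\in\mathcal{R}}$ a probability vector; $\Omega$ is the space of environments (product topology, Borel $\sigma$-algebra $\mathcal{B}$), $(T_z\omega)_x=\omega_{x+z}$, and $\mathbb{P}$ is a probability on $\Omega$ stationary and ergodic under shifts. An environment kernel is a function $\hat\pi:\Omega\times\mathcal{R}\to[0,\infty)$ with $\hat\pi(\cdot,z)$ measurable for each $z$ and $\sum_{z\in\mathcal{R}}\hat\pi(\cdot,z)=1$ $\mathbb{P}$-a.s. For $x\in\mathbb{Z}$, $\omega\in\Omega$, $P_x^{\hat\pi,\omega}$ is the law of the Markov chain $(X_n)_{n\ge0}$ with $X_0=x$ and $P(X_{n+1}=y+z\mid X_n=y)=\hat\pi(T_y\omega,z)$; $P_x^{\hat\pi}:=\mathbb{P}\times P_x^{\hat\pi,\omega}$ (the averaged law $\int P_x^{\hat\pi,\omega}(\cdot)\,\mathrm{d}\mathbb{P}(\omega)$), with expectations $E_x^{\hat\pi,\omega}$, $E_x^{\hat\pi}$. *)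

(* Defs.v *)
From HB Require Import structures.
From mathcomp Require Import all_boot all_order all_algebra.
From mathcomp Require Import all_classical all_reals all_analysis.
Set Implicit Arguments. Unset Strict Implicit. Unset Printing Implicit Defensive.
Import Order.TTheory GRing.Theory Num.Theory.
Local Open Scope classical_set_scope.
Local Open Scope ring_scope.

(* ---------- Steps: R_B = {z in Z : 0 < |z| <= B}, indexed by 'I_(2B) ----- *)
Definition step (B : nat) := 'I_(B.*2).
Definition stepz (B : nat) (i : step B) : int :=
  if (i < B)%N then (i%:Z - B%:Z)%R else (i%:Z - B%:Z + 1)%R.

(* omega x i = pi(x, x + stepz i); carrier: all such families.  The
   probability-vector constraint is imposed as a P-a.s. hypothesis.           *)
Definition env_carrier (R : realType) (B : nat) := int -> step B -> R.
HB.instance Definition _ (R : realType) (B : nat) := gen_eqMixin (env_carrier R B).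
HB.instance Definition _ (R : realType) (B : nat) := gen_choiceMixin (env_carrier R B).
HB.instance Definition _ (R : realType) (B : nat) :=
  isPointed.Build (env_carrier R B) (fun _ _ => 0).

(* generating class: preimages of Borel sets under the coordinate maps; for a
   countable product of second countable spaces this generates the Borel
   sigma-algebra of the product topology. *)
Definition env_gen (R : realType) (B : nat) : set (set (env_carrier R B)) :=
  [set A | exists (x : int) (i : step B) (U : set R),
      measurable U /\ A = (fun w : env_carrier R B => w x i) @^-1` U].

Notation Omega R B := (g_sigma_algebraType (@env_gen R B)).

Definition envshift (R : realType) (B : nat) (z : int) (w : Omega R B) : Omega R B :=
  fun x => w (x + z)%R.

Definition is_env (R : realType) (B : nat) (w : Omega R B) : Prop :=
  forall x : int, (forall i, 0 <= w x i) /\ \sum_(i : step B) w x i = 1.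

Definition stationary (R : realType) (B : nat) (P : probability (Omega R B) R) :=
  forall (z : int) (A : set (Omega R B)), measurable A ->
    P (envshift z @^-1` A) = P A.

Definition ergodic (R : realType) (B : nat) (P : probability (Omega R B) R) :=
  forall A : set (Omega R B), measurable A ->
    (forall z : int, envshift z @^-1` A = A) -> P A = 0%E \/ P A = 1%E.

Definition env_kernel (R : realType) (B : nat) (P : probability (Omega R B) R)
    (pihat : Omega R B -> step B -> R) : Prop :=
  [/\ forall i, measurable_fun setT (fun w => pihat w i),
      forall w i, 0 <= pihat w i &
      {ae P, forall w, \sum_(i : step B) pihat w i = 1}].

(* ---------- Quenched law P_x^{pihat,w} through finite-dim marginals -------- *)
Fixpoint pathp (R : realType) (B : nat) (pihat : Omega R B -> step B -> R)
    (w : Omega R B) (x : int) (s : seq (step B)) : R :=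
  match s with
  | [::] => 1
  | i :: s' => pihat (envshift x w) i * pathp pihat w (x + stepz i)%R s'
  end.

Fixpoint positions (B : nat) (x : int) (s : seq (step B)) : seq int :=
  match s with
  | [::] => [:: x]
  | i :: s' => x :: positions (x + stepz i)%R s'
  end.

Definition prob_at (R : realType) (B : nat) (pihat : Omega R B -> step B -> R)
    (w : Omega R B) (x : int) (n : nat) (y : int) : R :=
  \sum_(s : n.-tuple (step B) | last x (behead (positions x s)) == y)
     pathp pihat w x s.

(* E_x^{pihat,w}[ sum_k 1_{X_k = y} ] = sum_k P_x^{pihat,w}(X_k = y) *)
Definition green (R : realType) (B : nat) (pihat : Omega R B -> step B -> R)
    (w : Omega R B) (x y : int) : \bar R :=
  \sum_(0 <= k <oo) (prob_at pihat w x k y)%:E.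

(* P_0^{pihat,w}(t_1 > n) = P_0^{pihat,w}(X_0 <= 0, ..., X_n <= 0),
   with t_1 = inf{k >= 0 : X_k >= 1} *)
Definition prob_t1_gt (R : realType) (B : nat) (pihat : Omega R B -> step B -> R)
    (w : Omega R B) (n : nat) : R :=
  \sum_(s : n.-tuple (step B) | all (fun y : int => y <= 0) (positions 0 s))
     pathp pihat w 0 s.

(* E_0^{pihat,w}[t_1] = sum_{n >= 0} P_0^{pihat,w}(t_1 > n)  (in [0, +oo]) *)
Definition quenched_Et1 (R : realType) (B : nat) (pihat : Omega R B -> step B -> R)
    (w : Omega R B) : \bar R :=
  \sum_(0 <= n <oo) (prob_t1_gt pihat w n)%:E.

Lemma step_one_lt (B : nat) : (0 < B)%N -> (B < B.*2)%N.
Proof. by move=> hB; rewrite -addnn -{1}(addn0 B) ltn_add2l. Qed.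
Definition step_one (B : nat) (hB : (0 < B)%N) : step B :=
  @Ordinal (B.*2) B (step_one_lt hB).
Lemma stepz_one (B : nat) (hB : (0 < B)%N) : stepz (step_one hB) = 1%R.
Proof. by rewrite /stepz /= ltnn subrr add0r. Qed.

(* Main.v *)
(* Write G(x,0) for the Green function of the quenched chain.  Cut the path at the
   successive times t_m at which it first reaches a site >= m: the piece between
   t_m and t_{m+1} is nonempty only if X_{t_m} = m, and visits 0 only if m >= 0, so
   G(x,0) <= H := sum_{m >= 0} E_m[visits to 0 before t_{m+1}] for all x.  By
   stationarity the mean of the m-th term is E_0[visits to -m before t_1], so
   that E[H] <= E_0[t_1] < oo.  Hence G(.,0) is a.s. bounded; it is harmonic on
   the negative half-line, where it obeys a maximum principle on windows of
   length B because all the times t_{x+1} are a.s. finite under P_x.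
   From a stretch of B sites at which the jump +1 has probability at least e, the
   chain reaches the site above the stretch with probability at least e^B, which
   contracts the oscillation of G(.,0) by the factor 1 - e^B; Poincare recurrence
   provides infinitely many such stretches towards -oo.  So G(x,0) converges as
   x -> -oo; the limit is positive by the minimum principle, is at most H, and
   inherits invariance from the last-step decomposition of G(x,0). *)
Require Import Defs.
From HB Require Import structures.
From mathcomp Require Import all_boot all_order all_algebra.
From mathcomp Require Import all_classical all_reals all_analysis.
From mathcomp Require Import measurable_realfun zify lra.
Set Implicit Arguments. Unset Strict Implicit. Unset Printing Implicit Defensive.
Import Order.TTheory GRing.Theory Num.Theory.
Import numFieldNormedType.Exports.
Local Open Scope classical_set_scope.
Local Open Scope ring_scope.

Lemma cvg_sumr (R : realType) (I : finType) (f : I -> nat -> R) (l : I -> R) :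
  (forall i, f i n @[n --> \oo] --> l i) ->
  \sum_i f i n @[n --> \oo] --> \sum_i l i.
Proof. by move=> fl; apply: cvg_big => [|i _]; [exact: add_continuous|exact: fl]. Qed.

(** * Killed chains on the integers *)

Section KilledChain.
Variables (R : realType) (B : nat) (q : int -> step B -> R).

(* [run A f n x] is E_x[f(X_n); X_0, ..., X_n \in A] for the chain with jump
   probabilities [q]. *)
Fixpoint run (A : pred int) (f : int -> R) (n : nat) (x : int) : R :=
  if A x then
    if n is m.+1 then \sum_(i < B.*2) q x i * run A f m (x + stepz i) else f x
  else 0.

Definition visits (A : pred int) (y : int) (n : nat) (x : int) : R :=
  \sum_(k < n) run A (fun u => (u == y)%:R) k x.

Lemma run0E (A : pred int) (f : int -> R) x : run A f 0 x = if A x then f x else 0.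
Proof. by []. Qed.

Lemma runSE (A : pred int) (f : int -> R) n x : run A f n.+1 x =
  if A x then \sum_(i < B.*2) q x i * run A f n (x + stepz i) else 0.
Proof. by []. Qed.

Lemma run_out (A : pred int) (f : int -> R) n x : ~~ A x -> run A f n x = 0.
Proof. by case: n => [|n] /negbTE /= ->. Qed.

Lemma visits_out (A : pred int) y n x : ~~ A x -> visits A y n x = 0.
Proof. by move=> Ax; rewrite /visits big1 // => k _; rewrite run_out. Qed.

Lemma run_eq0 (A : pred int) (f : int -> R) n x : (forall u : int, A u -> f u = 0) -> run A f n x = 0.
Proof.
move=> f0; elim: n x => [|n IH] x /=; case: ifP => // Ax; first exact: f0.
by rewrite big1 // => i _; rewrite IH mulr0.
Qed.

Lemma visits_target_out (A : pred int) y n x : ~~ A y -> visits A y n x = 0.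
Proof.
move=> Ay; rewrite /visits big1 // => k _; apply: run_eq0 => u Au.
by case: eqP => // uy; rewrite uy (negbTE Ay) in Au.
Qed.

(** [run] unfolds at its first jump; induction transfers the unfolding to the last one. Under
    [predT] the final position undergoes no killing test. *)
Lemma run_last_step f n x :
  run predT f n.+1 x =
  run predT (fun y => \sum_(i < B.*2) q y i * f (y + stepz i)) n x.
Proof.
elim: n x => [|n IH] x //.
by rewrite runSE /= [RHS]/=; apply: eq_bigr => i _; rewrite -IH.
Qed.

Lemma run_sum (A : pred int) (I : finType) (c : I -> R) (f : I -> int -> R) n x :
  run A (fun y => \sum_i c i * f i y) n x = \sum_i c i * run A (f i) n x.
Proof.
elim: n x => [|n IH] x /=; case: ifP => // _.
- by rewrite big1 // => i _; rewrite mulr0.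
- under eq_bigr => j _ do rewrite IH mulr_sumr.
  rewrite exchange_big /=; apply: eq_bigr => i _; rewrite mulr_sumr.
  by apply: eq_bigr => j _; rewrite mulrCA.
- by rewrite big1 // => i _; rewrite mulr0.
Qed.

(** Jump [i] lands on 0 exactly when it starts from [- stepz i]. Summed over [k], this becomes the
    invariance equation. *)
Lemma run_occupation_step k x :
  run predT (fun u => (u == 0)%:R) k.+1 x =
  \sum_(i < B.*2) q (- stepz i) i * run predT (fun u => (u == - stepz i)%:R) k x.
Proof.
rewrite run_last_step -run_sum; congr run; apply: funext => y.
apply: eq_bigr => i _; rewrite addr_eq0.
by case: eqP => [->|_] //; rewrite !mulr0.
Qed.

Lemma visitsSE (A : pred int) y n x : visits A y n.+1 x =
  if A x then (x == y)%:R + \sum_(i < B.*2) q x i * visits A y n (x + stepz i)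
  else 0.
Proof.
case: ifP => Ax; last by rewrite visits_out ?Ax.
rewrite /visits big_ord_recl run0E Ax; congr (_ + _).
under eq_bigr => k _ do rewrite lift0 runSE Ax.
rewrite exchange_big /=; apply: eq_bigr => i _.
by rewrite mulr_sumr.
Qed.

Lemma stepz_le (i : step B) : stepz i <= B%:Z.
Proof. by rewrite /stepz; case: i => i hi /=; case: ifP => _; lia. Qed.

(** Each jump goes up by at most [B], so within [n] jumps the chain cannot pass [m] and the killing
    is never felt. *)
Lemma run_unkilled (m : int) f n x : x + n%:Z * B%:Z <= m ->
  run predT f n x = run (fun u : int => u <= m) f n x.
Proof.
elim: n x => [|n IH] x hx /=.
  by rewrite ifT //; lia.
rewrite ifT; last by lia.
apply: eq_bigr => i _; rewrite IH //.
by have := stepz_le i; lia.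
Qed.

Hypothesis q_ge0 : forall x i, 0 <= q x i.

Lemma run_ge0 (A : pred int) (f : int -> R) n x : (forall u, 0 <= f u) -> 0 <= run A f n x.
Proof.
move=> f0; elim: n x => [|n IH] x /=; case: ifP => // _.
by apply: sumr_ge0 => i _; rewrite mulr_ge0.
Qed.

Lemma run_le (A : pred int) (f g : int -> R) n x :
  (forall u, f u <= g u) -> run A f n x <= run A g n x.
Proof.
move=> fg; elim: n x => [|n IH] x /=; case: ifP => // _.
by apply: ler_sum => i _; rewrite ler_wpM2l.
Qed.

Lemma visits_ge0 (A : pred int) y n x : 0 <= visits A y n x.
Proof. by apply: sumr_ge0 => k _; apply: run_ge0 => u; rewrite ler0n. Qed.

Lemma visits_nd (A : pred int) y x : nondecreasing_seq (fun n => visits A y n x).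
Proof.
apply/nondecreasing_seqP => n.
rewrite /visits big_ord_recr lerDl.
by apply: run_ge0 => u; rewrite ler0n.
Qed.

(** * Stochastic kernels and the ladder decomposition of visits *)

Hypothesis q_sum1 : forall x, \sum_(i < B.*2) q x i = 1.

Lemma q_le1 x i : q x i <= 1.
Proof. by rewrite -(q_sum1 x) (bigD1 i) //= lerDl sumr_ge0. Qed.

Lemma mean_cst x (c : R) : \sum_(i < B.*2) q x i * c = c.
Proof. by rewrite -mulr_suml q_sum1 mul1r. Qed.

(* Visits above level [m - 1] made before exceeding [m] happen after the first
   entrance to [m], which then is at the site [m] itself. *)
Lemma visits_level (m y : int) n N x : (n <= N)%N ->
  visits (fun u : int => u <= m) y n x <=
  visits (fun u : int => u <= m - 1) y n x + visits (fun u : int => u <= m) y N m.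
Proof.
elim: n x => [|n IH] x nN.
  by rewrite /visits !big_ord0 add0r sumr_ge0 // => k _; apply: run_ge0.
have [xm|] := boolP (x <= m - 1); last first.
  move=> xm; rewrite [X in _ <= X + _]visits_out // add0r.
  have [->|xm'] := eqVneq x m; first exact: visits_nd.
  rewrite visits_out ?visits_ge0 //; lia.
rewrite !visitsSE ifT; last by lia.
rewrite xm -addrA lerD2l.
(* The last term does not depend on the starting point, so it equals its mean over the first
   jump. *)
rewrite -[X in _ <= _ + X](mean_cst x) -big_split /=.
apply: ler_sum => i _; rewrite -mulrDr ler_wpM2l //.
by apply: IH; exact: ltnW.
Qed.

Lemma visits_level_sum (m n : nat) (x : int) :
  visits (fun u : int => u <= m%:Z) 0 n x <=
  \sum_(j < m.+1) visits (fun u : int => u <= j%:Z) 0 n j%:Z.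
Proof.
elim: m => [|m IH].
  rewrite big_ord_recl big_ord0 addr0.
  apply: le_trans (visits_level 0 0 x (leqnn n)) _.
  (* A chain killed above -1 never visits 0, so the levels start at 0. *)
  by rewrite visits_target_out ?add0r //.
rewrite big_ord_recr /=.
apply: le_trans (visits_level _ _ x (leqnn n)) _.
rewrite lerD2r; apply: le_trans IH.
by rewrite (_ : m.+1%:Z - 1 = m%:Z) //; lia.
Qed.

Lemma visits_le_ladder (n : nat) (x : int) :
  exists m : nat, visits predT 0 n x <=
  \sum_(j < m) visits (fun u : int => u <= j%:Z) 0 n j%:Z.
Proof.
(* Up to time [n] the chain stays below this level; only the number of summands depends on [x], not
   the summands. *)
pose m := (`|x| + n * B)%N; exists m.+1.
apply: le_trans (visits_level_sum m n x).
apply: ler_sum => k _; rewrite (@run_unkilled m%:Z) //.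
have : (k * B <= n * B)%N by rewrite leq_mul2r ltnW ?orbT.
by rewrite /m; lia.
Qed.

(** * Maximum principle, contraction of oscillation and convergence of harmonic functions *)

Section MaximumPrinciple.
Hypothesis exit_as : forall y : int,
  (run (fun u : int => u <= y) (cst 1) n y @[n --> \oo] --> (0 : R)).

(** Leaving the half-line up to [y], the chain lands in the window, where [u] is at most [c]; before
    that the excess is at most [M], with a weight that vanishes by [exit_as]. That hypothesis
    concerns only the start [y], hence the bound at [y] alone. *)
Lemma max_principle1 (u : int -> R) (y : int) (c M : R) : 0 <= M ->
  (forall x : int, x <= y -> u x <= \sum_(i < B.*2) q x i * u (x + stepz i)) ->
  (forall x : int, x <= y -> u x <= c + M) ->
  (forall x : int, y < x <= y + B%:Z -> u x <= c) -> u y <= c.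
Proof.
move=> M0 sub bnd win.
have key n : forall x, x <= y + B%:Z ->
    u x <= c + M * run (fun u : int => u <= y) (cst 1) n x.
  elim: n => [|n IH] x xB.
    rewrite run0E; case: ifP => xy; first by rewrite mulr1; exact: bnd.
    by rewrite mulr0 addr0; apply: win; lia.
  rewrite runSE; case: ifP => xy; last first.
    by rewrite mulr0 addr0; apply: win; lia.
  apply: le_trans (sub _ xy) _.
  rewrite -[X in X + _](mean_cst x) mulr_sumr -big_split /=.
  apply: ler_sum => i _; rewrite mulrCA -mulrDr ler_wpM2l // IH //.
  by have := stepz_le i; lia.
have cv : (c + M * run (fun u : int => u <= y) (cst 1) n y @[n --> \oo] --> c).
  rewrite -[X in _ --> X]addr0 -(mulr0 M).
  by apply: cvgD; [exact: cvg_cst | apply: cvgMr; exact: exit_as].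
rewrite -(cvg_lim (@Rhausdorff R) cv).
apply: limr_ge; first by apply/cvg_ex; exists c.
by near=> n; apply: key; lia.
Unshelve. all: by end_near. Qed.

Lemma max_principle (u : int -> R) (y : int) (c M : R) :
  (forall x : int, x <= y -> u x <= \sum_(i < B.*2) q x i * u (x + stepz i)) ->
  (forall x : int, x <= y -> u x <= M) ->
  (forall x : int, y < x <= y + B%:Z -> u x <= c) ->
  forall x : int, x <= y + B%:Z -> u x <= c.
Proof.
move=> sub bnd win.
(* The bound descends one site at a time: the [B] sites above the next one already satisfy it and
   form its window. *)
have key (k : nat) : forall x, y - k%:Z < x <= y + B%:Z -> u x <= c.
  elim: k => [|k IH] x hx; first by apply: win; lia.
  have [xk|xk] := ltP (y - k%:Z) x; first by apply: IH; lia.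
  apply: (@max_principle1 u x c `|M - c|) => // z hz.
  - by apply: sub; lia.
  - have : u z <= M by apply: bnd; lia.
    by have := ler_norm (M - c); lra.
  - by apply: IH; lia.
by move=> x hx; apply: (key (`|y - x|).+1); lia.
Qed.

Lemma min_principle (u : int -> R) (y : int) (c M : R) :
  (forall x : int, x <= y -> \sum_(i < B.*2) q x i * u (x + stepz i) <= u x) ->
  (forall x : int, x <= y -> M <= u x) ->
  (forall x : int, y < x <= y + B%:Z -> c <= u x) ->
  forall x : int, x <= y + B%:Z -> c <= u x.
Proof.
move=> sup bnd win x hx; rewrite -lerN2.
apply: (@max_principle (fun z => - u z) y _ (- M)) => // z hz.
- rewrite -lerN2 -sumrN opprK; under eq_bigr => i _ do rewrite mulrN opprK.
  exact: sup.
- by rewrite lerN2 bnd.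
- by rewrite lerN2 win.
Qed.

Variable hB : (0 < B)%N.

(* From y + j, with 0 <= j < B, at most B jumps +1 of probability at least e lead
   to y + B; on the complementary event u is at most D. *)
Lemma ascent_contraction (u : int -> R) (y : int) (D e : R) :
  0 <= e <= 1 ->
  (forall x : int, x < y + B%:Z -> u x <= \sum_(i < B.*2) q x i * u (x + stepz i)) ->
  (forall x : int, x < y + B%:Z + B%:Z -> u x <= D) ->
  (forall x : int, y <= x < y + B%:Z -> e <= q x (step_one hB)) ->
  forall x : int, x < y + B%:Z -> u x <= e ^+ B * u (y + B%:Z) + (1 - e ^+ B) * D.
Proof.
move=> /andP[e0 e1] sub bnd good.
have asc (j : nat) : (j <= B)%N ->
    u (y + B%:Z - j%:Z) <= e ^+ j * u (y + B%:Z) + (1 - e ^+ j) * D.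
  elim: j => [|j IH] jB.
    by rewrite subr0 expr0 subrr mul0r mul1r addr0.
  set x := y + B%:Z - _.
  apply: le_trans (sub x _) _; first by rewrite /x; lia.
  rewrite (bigD1 (step_one hB)) //= stepz_one.
  have -> : x + 1 = y + B%:Z - j%:Z by rewrite /x; lia.
  have qe : e <= q x (step_one hB) by apply: good; rewrite /x; lia.
  have rest : \sum_(i < B.*2 | i != step_one hB) q x i * u (x + stepz i) <=
      (1 - q x (step_one hB)) * D.
    have -> : 1 - q x (step_one hB) = \sum_(i < B.*2 | i != step_one hB) q x i.
      by rewrite -(q_sum1 x) (bigD1 (step_one hB)) //= addrC addrK.
    rewrite mulr_suml; apply: ler_sum => i _; rewrite ler_wpM2l // bnd //.
    by have := stepz_le i; rewrite /x; lia.
  have IHj := IH (ltnW jB).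
  have uD : u (y + B%:Z - j%:Z) <= D by apply: bnd; lia.
  rewrite exprS; move: rest IHj uD qe (q_le1 x (step_one hB)).
  move: (\sum_(_ < _ | _) _) (q x _) (u (y + B%:Z - j%:Z)) (u (y + B%:Z)).
  move=> s r v w rest IHj vD er r1; nra.
move=> x xy.
(* A start nearer to the top needs fewer jumps, and lowering the weight of [u (y + B)] to [e ^+ B]
   only raises the bound, since that value is at most [D]. *)
have main z : y <= z < y + B%:Z -> u z <= e ^+ B * u (y + B%:Z) + (1 - e ^+ B) * D.
  move=> hz.
  have zE : z = y + B%:Z - (`|(y + B%:Z - z)%R|)%N%:Z by lia.
  have jB : (`|(y + B%:Z - z)%R| <= B)%N by lia.
  rewrite {1}zE; apply: le_trans (asc _ jB) _.
  have wD : u (y + B%:Z) <= D by apply: bnd; lia.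
  have ee : e ^+ B <= e ^+ `|(y + B%:Z - z)%R|%N by rewrite ler_wiXn2l.
  nra.
(* The stretch itself is the window above [y - 1], so the bound extends to every site below it. *)
apply: (@max_principle u (y - 1) _ D) => [z hz|z hz|z hz|].
- by apply: sub; lia.
- by apply: bnd; lia.
- by apply: main; lia.
- by lia.
Qed.

Lemma descent_contraction (u : int -> R) (y : int) (d e : R) :
  0 <= e <= 1 ->
  (forall x : int, x < y + B%:Z -> \sum_(i < B.*2) q x i * u (x + stepz i) <= u x) ->
  (forall x : int, x < y + B%:Z + B%:Z -> d <= u x) ->
  (forall x : int, y <= x < y + B%:Z -> e <= q x (step_one hB)) ->
  forall x : int, x < y + B%:Z -> e ^+ B * u (y + B%:Z) + (1 - e ^+ B) * d <= u x.
Proof.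
move=> e01 sup bnd good x xy; rewrite -lerN2 opprD -!mulrN.
apply: (@ascent_contraction (fun z => - u z) y (- d) e) => // z hz.
- rewrite -lerN2 -sumrN opprK; under eq_bigr => i _ do rewrite mulrN opprK.
  exact: sup.
- by rewrite lerN2 bnd.
Qed.

Variable e : R.
Hypothesis e_gt0 : 0 < e.
Hypothesis good_sites : forall N : nat, exists2 y : int, y <= - N%:Z &
  forall x : int, y <= x < y + B%:Z -> e <= q x (step_one hB).

Lemma harmonic_cvg (u : int -> R) (M : R) :
  (forall x : int, x < 0 -> u x = \sum_(i < B.*2) q x i * u (x + stepz i)) ->
  (forall x : int, `|u x| <= M) ->
  cvgn (fun n : nat => u (- n%:Z)).
Proof.
move=> harm bnd.
have e1 : e <= 1.
  have [y _ good] := good_sites 0; apply: le_trans (q_le1 y (step_one hB)).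
  by apply: good; lia.
have eB0 : 0 < e ^+ B by rewrite exprn_gt0.
have eB1 : e ^+ B <= 1 by rewrite exprn_ile1 // ltW.
have M0 : 0 <= M by apply: le_trans (bnd 0); rewrite normr_ge0.
(* One good stretch per [k]: the new lower and upper bounds share the term in [u (y + B)], which
   cancels in their difference. *)
have sqz (k : nat) : exists (N : nat) (d D : R),
    (forall x : int, x <= - N%:Z -> d <= u x <= D) /\ D - d = (1 - e ^+ B) ^+ k * (2 * M).
  elim: k => [|k [N [d [D [dD E]]]]].
    exists 0, (- M), M; split; last by rewrite expr0; lra.
    by move=> x _; rewrite -ler_norml.
  (* The contraction needs the old bounds up to [y + B + B]; the offset [B.*2] keeps this below
     [- N]. *)
  have [y yN good] := good_sites (N + B.*2).
  exists `|y|%N, (e ^+ B * u (y + B%:Z) + (1 - e ^+ B) * d),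
    (e ^+ B * u (y + B%:Z) + (1 - e ^+ B) * D); split; last first.
    by rewrite exprS -mulrA -E; lra.
  move=> x hx; apply/andP; split.
  - apply: (@descent_contraction u y d e); rewrite ?(ltW e_gt0) //.
    + by move=> z hz; rewrite -harm //; lia.
    + by move=> z hz; have /andP[] : d <= u z <= D by apply: dD; lia.
    + by lia.
  - apply: (@ascent_contraction u y D e); rewrite ?(ltW e_gt0) //.
    + by move=> z hz; rewrite -harm //; lia.
    + by move=> z hz; have /andP[] : d <= u z <= D by apply: dD; lia.
    + by lia.
apply/cauchy_cvgP/cauchy_exP => eps eps0.
have cv : ((1 - e ^+ B) ^+ k * (2 * M) @[k --> \oo] --> (0 : R)).
  rewrite -(mul0r (2 * M)); apply: cvgMl; apply: cvg_expr.
  by rewrite ger0_norm; lra.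
have /cvgrPdist_lt/(_ eps eps0)[k _ /(_ k (leqnn k))/=] := cv.
rewrite sub0r normrN => hk.
have [N [d [D [dD E]]]] := sqz k.
exists d; exists N => // n /= hn.
have /andP[d1 d2] : d <= u (- n%:Z) <= D by apply: dD; lia.
rewrite /ball /= ler0_norm; last by lra.
have := ler_norm ((1 - e ^+ B) ^+ k * (2 * M)); move: hk => /=; lra.
Unshelve. all: by end_near. Qed.

Hypothesis q_one : forall x, 0 < q x (step_one hB).
Variable C : R.
Hypothesis visits_bounded : forall n x, visits predT 0 n x <= C.

Lemma visits_cvg x : visits predT 0 n x @[n --> \oo] --> limn (visits predT 0 ^~ x).
Proof.
apply: nondecreasing_is_cvgn; first exact: visits_nd.
by exists C => _ [n _ <-].
Qed.

Lemma green_limit_gt0 : exists2 l : R, 0 < l &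
  limn (fun k => visits predT 0 k (- n%:Z)) @[n --> \oo] --> l.
Proof.
pose h x : R := limn (visits predT 0 ^~ x).
(* First-step decomposition of the Green function [h] of the target 0, in the limit of infinite
   horizon. *)
have hE x : h x = (x == 0)%:R + \sum_(i < B.*2) q x i * h (x + stepz i).
  apply: (cvg_lim (@Rhausdorff R)).
  rewrite -(cvg_shiftS (fun n => visits predT 0 n x)) /=.
  under eq_cvg do rewrite visitsSE /=.
  apply: cvgD; first exact: cvg_cst.
  apply: cvg_sumr => i; apply: cvgMr; exact: visits_cvg.
have h0 x : 0 <= h x.
  apply: limr_ge; first exact: visits_cvg.
  by near=> n; exact: visits_ge0.
have hC x : h x <= C.
  apply: limr_le; first exact: visits_cvg.
  by near=> n; exact: visits_bounded.
have harm x : x < 0 -> h x = \sum_(i < B.*2) q x i * h (x + stepz i).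
  by move=> x0; rewrite hE lt_eqF // add0r.
have cv := @harmonic_cvg h C harm (fun x => _).
have {}cv : cvgn (fun n : nat => h (- n%:Z)).
  by apply: cv => x; rewrite ger0_norm.
have hpos (j : nat) : 0 < h (- j%:Z).
  elim: j => [|j IH].
    by rewrite hE oppr0 eqxx ltr_pwDl ?ltr01 // sumr_ge0 // => i _; rewrite mulr_ge0.
  rewrite harm; last by lia.
  rewrite (bigD1 (step_one hB)) //= stepz_one ltr_pwDl //.
    by rewrite (_ : - j.+1%:Z + 1 = - j%:Z) ?mulr_gt0 //; lia.
  by rewrite sumr_ge0 // => i _; rewrite mulr_ge0.
have [c c0 cle] : exists2 c : R, 0 < c & forall j : nat, (j <= B)%N -> c <= h (- j%:Z).
  elim: (B) => [|b [c c0 cb]].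
    by exists (h 0) => [|j]; rewrite ?(hpos 0) // leqn0 => /eqP ->.
  exists (Num.min c (h (- b.+1%:Z))); first by rewrite lt_min c0 hpos.
  move=> j; rewrite leq_eqVlt => /orP[/eqP ->|jb]; rewrite ge_min ?lexx ?orbT //.
  by rewrite cb.
exists (limn (fun n : nat => h (- n%:Z))); last exact: cv.
apply: lt_le_trans c0 _; apply: limr_ge => //.
near=> n.
(* With this choice the window is the set of sites from [- B] to -1, just below the source at 0. *)
apply: (@min_principle h (- B%:Z - 1) c 0) => [x hx|x _|x hx|].
- by rewrite -harm //; lia.
- exact: h0.
- have -> : x = - (`|x|%N)%:Z by lia.
  by apply: cle; lia.
- have : (1 <= n)%N by near: n; exists 1%N.
  by lia.
Unshelve. all: by end_near. Qed.

End MaximumPrinciple.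
End KilledChain.

(** * Recurrence of measure-preserving maps *)

Section MeasurePreserving.
Context d (T : measurableType d) (R : realType).

Lemma ae_preimage (P : {measure set T -> \bar R}) (S : T -> T) (Q : T -> Prop) :
  measurable_fun setT S ->
  (forall A, measurable A -> P (S @^-1` A) = P A) ->
  {ae P, forall w, Q w} -> {ae P, forall w, Q (S w)}.
Proof.
move=> mS PS [A [mA A0 QA]]; exists (S @^-1` A); split.
- by rewrite -[_ @^-1` _]setTI; exact: mS.
- by rewrite PS.
- by move=> w /= nQ; exact: QA.
Qed.

Lemma ge0_integral_preserving (P : {measure set T -> \bar R}) (S : T -> T)
    (f : T -> \bar R) :
  measurable_fun setT S ->
  (forall A, measurable A -> P (S @^-1` A) = P A) ->
  measurable_fun setT f -> (forall w, 0 <= f w)%E ->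
  (\int[P]_w f (S w) = \int[P]_w f w)%E.
Proof.
move=> mS PS mf f0.
pose mS_mixin := isMeasurableFun.Build _ _ _ _ _ mS.
pose S_pack : {mfun T >-> T} := HB.pack S mS_mixin.
transitivity (\int[pushforward P S_pack]_w f w)%E.
  by rewrite ge0_integral_pushforward.
by apply: eq_measure_integral => A mA _; exact: PS.
Qed.

Variables (P : probability T R) (S : T -> T).
Hypothesis mS : measurable_fun setT S.
Hypothesis PS : forall A, measurable A -> P (S @^-1` A) = P A.

Let mpreimage n A : measurable A -> measurable (iter n S @^-1` A).
Proof.
elim: n A => [|n IH] A mA //.
rewrite (_ : iter n.+1 S @^-1` A = iter n S @^-1` (S @^-1` A)) //.
by apply: IH; rewrite -[_ @^-1` _]setTI; exact: mS.
Qed.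

Let Ppreimage n A : measurable A -> P (iter n S @^-1` A) = P A.
Proof.
elim: n A => [|n IH] A mA //.
rewrite (_ : iter n.+1 S @^-1` A = iter n S @^-1` (S @^-1` A)) //.
by rewrite IH ?PS // -[_ @^-1` _]setTI; exact: mS.
Qed.

(** The points of [A] that never return at a positive multiple of [N.+1] form a set whose preimages
    under the iterates of [S] by these multiples are disjoint and of equal measure; total mass 1
    forces that measure to be 0. *)
Lemma poincare_recurrence (A : set T) : measurable A ->
  {ae P, forall w, A w -> forall N, exists2 n, (N <= n)%N & A (iter n S w)}.
Proof.
move=> mA.
(* A return at a positive multiple of [N.+1] is a return after time [N]; there are countably many
   [N]. *)
suff rec N : {ae P, forall w, A w -> exists k, A (iter (k.+1 * N.+1) S w)}.
  have [Z [mZ Z0 AZ]] := ae_foralln rec; exists Z; split => //.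
  apply: subset_trans AZ => w /= nA h; apply: nA => Aw N.
  have [k Ak] := h N Aw; exists (k.+1 * N.+1)%N => //.
  by rewrite (leq_trans (leqnSn N)) // leq_pmull.
pose E := A `&` \bigcap_k ~` (iter (k.+1 * N.+1) S @^-1` A).
have mE : measurable E.
  apply: measurableI => //; apply: bigcapT_measurable => k.
  by apply: measurableC; exact: mpreimage.
exists E; split => //; last first.
  move=> w /= /not_implyP[Aw nA]; split => // k _ /= Ak.
  by apply: nA; exists k.
pose F k := iter (k * N.+1) S @^-1` E.
have mF k : measurable (F k) by exact: mpreimage.
have tF : trivIset setT F.
  apply/trivIsetP => i j _ _; wlog ij : i j / (i < j)%N => [hw|_].
    rewrite neq_ltn => /orP[ij|ji]; first by apply: hw => //; rewrite lt_eqF.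
    by rewrite setIC; apply: hw => //; rewrite lt_eqF.
  rewrite -subset0 => w [[_ Ei] [Ej _]].
  apply: (Ei (j - i).-1 I).
  rewrite prednK ?subn_gt0 // /preimage /mkset -iterD -mulnDl subnK //.
  exact: ltnW.
have : (\sum_(0 <= k <oo) P E <= 1)%E.
  rewrite (_ : \sum_(0 <= k <oo) P E = P (\bigcup_k F k))%E; last first.
    rewrite measure_bigcup //; congr (limn _); apply: funext => n.
    by apply: eq_big => [k|k _]; [rewrite in_setT|rewrite -(Ppreimage (k * N.+1) mE)].
  by apply: probability_le1; exact: bigcupT_measurable.
have [//|E0] := eqVneq (P E) 0%E.
have Efin : P E \is a fin_num by exact: fin_num_measure.
have pos : (0 < fine (P E))%R.
  by rewrite fine_gt0 // lt0e E0 measure_ge0 ltey_eq Efin.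
have [n nE] : exists n : nat, 1 < fine (P E) *+ n.
  exists (Num.bound (fine (P E))^-1).
  rewrite -mulr_natr -ltr_pdivrMl // mulr1.
  by apply: archi_boundP; rewrite invr_ge0 ltW.
move=> h; have : (\sum_(0 <= k < n) P E <= 1)%E.
  by apply: le_trans h; apply: nneseries_lim_ge.
under eq_bigr do rewrite -(fineK Efin).
rewrite sumEFin sumr_const_nat subn0 lee_fin.
by rewrite leNgt nE.
Qed.

End MeasurePreserving.

(** * The quenched chain *)

Section Environment.
Variables (R : realType) (B : nat).
Implicit Types (w : Omega R B) (A : pred int) (f : int -> R).

Lemma envshift_comp (x z : int) w : envshift x (envshift z w) = envshift (x + z) w.
Proof. by apply: funext => a; rewrite /envshift addrA. Qed.

Lemma envshift0 w : envshift 0 w = w.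
Proof. by apply: funext => a; rewrite /envshift addr0. Qed.

Lemma iter_envshift (n : nat) w : iter n (envshift (-1)) w = envshift (- n%:Z) w.
Proof.
elim: n => [|n IH]; first by rewrite oppr0 envshift0.
by rewrite iterS IH envshift_comp; congr (envshift _ w); lia.
Qed.

Lemma measurable_envshift (z : int) :
  measurable_fun setT (@envshift R B z : Omega R B -> Omega R B).
Proof.
apply: (@measurability _ _ (Omega R B) (Omega R B) setT (@envshift R B z)
  (@env_gen R B) erefl).
move=> _ [_ [x [i [U [mU ->]]]] <-]; rewrite setTI.
apply: sub_sigma_algebra; exists (x + z), i, U; split => //.
Qed.

Lemma last_positions x (i : step B) s :
  last x (behead (positions x (i :: s))) =
  last (x + stepz i) (behead (positions (x + stepz i) s)).
Proof. by case: s. Qed.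

Variable pihat : Omega R B -> step B -> R.

Definition kern w (x : int) (i : step B) : R := pihat (envshift x w) i.

(** Splitting a tuple into head and tail turns the path sums that define the quenched law into the
    recursion [run]. *)
Lemma run_pathp w A f n x :
  \sum_(s : n.-tuple (step B) | all A (positions x s))
     pathp pihat w x s * f (last x (behead (positions x s))) =
  run (kern w) A f n x.
Proof.
elim: n x => [|n IH] x.
  rewrite big_mkcond (bigD1 [tuple]) //= big1 ?addr0; last first.
    by move=> s /eqP[]; exact: tuple0.
  by rewrite andbT mul1r.
pose h (p : step B * n.-tuple (step B)) : n.+1.-tuple (step B) :=
  [tuple of p.1 :: p.2].
rewrite (reindex h) /=; last first.
  exists (fun s : n.+1.-tuple (step B) => (thead s, [tuple of behead s])).
    by move=> [i s] _; congr pair; apply: val_inj.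
  by move=> s _; rewrite /h /= -tuple_eta.
case: ifP => Ax; last by rewrite big_pred0 // => -[i s] /=; rewrite Ax.
transitivity (\sum_(i < B.*2)
    \sum_(s : n.-tuple (step B) | all A (positions (x + stepz i) s))
      pathp pihat w x (i :: s) * f (last x (behead (positions x (i :: s))))).
  by rewrite pair_big_dep /=; apply: eq_bigl => -[i s]; rewrite /= ?Ax.
apply: eq_bigr => i _; rewrite -IH mulr_sumr; apply: eq_bigr => s _.
by rewrite -mulrA -last_positions.
Qed.

Lemma prob_atE w x n y :
  prob_at pihat w x n y = run (kern w) predT (fun u => (u == y)%:R) n x.
Proof.
rewrite -run_pathp /prob_at [RHS]big_mkcond [LHS]big_mkcond /=.
apply: eq_bigr => s _; rewrite all_predT.
by case: eqP => _; rewrite ?mulr1 ?mulr0.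
Qed.

Lemma prob_t1_gtE w n :
  prob_t1_gt pihat w n = run (kern w) (fun u : int => u <= 0) (cst 1) n 0.
Proof. by rewrite -run_pathp; apply: eq_bigr => s _; rewrite mulr1. Qed.

(** Shifting the environment amounts to translating the chain, with its start, killing set and test
    function. *)
Lemma run_kern_shift (z : int) w A f n x :
  run (kern (envshift z w)) A f n x =
  run (kern w) (fun u => A (u - z)) (fun u => f (u - z)) n (x + z).
Proof.
elim: n x => [|n IH] x /=; rewrite addrK; case: ifP => // _.
apply: eq_bigr => i _; rewrite IH {1}/kern envshift_comp.
by rewrite addrAC.
Qed.

Lemma visits_kern_shift (z : int) w A y n x :
  visits (kern (envshift z w)) A y n x =
  visits (kern w) (fun u => A (u - z)) (y + z) n (x + z).
Proof.
apply: eq_bigr => k _; rewrite run_kern_shift; congr run.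
by apply: funext => u; rewrite subr_eq.
Qed.

Lemma greenE w x y : green pihat w x y =
  (\sum_(0 <= k <oo) (run (kern w) predT (fun u => (u == y)%:R) k x)%:E)%E.
Proof. by apply: eq_eseriesr => k _; rewrite prob_atE. Qed.

Lemma quenched_Et1E w : quenched_Et1 pihat w =
  (\sum_(0 <= k <oo) (run (kern w) (fun u : int => u <= 0) (cst 1) k 0)%:E)%E.
Proof. by apply: eq_eseriesr => k _; rewrite prob_t1_gtE. Qed.

Lemma sum_run_visits w A y n x :
  (\sum_(0 <= k < n) (run (kern w) A (fun u => (u == y)%:R) k x)%:E)%E =
  (visits (kern w) A y n x)%:E.
Proof. by rewrite sumEFin big_mkord. Qed.

Hypothesis pihat_ge0 : forall w i, 0 <= pihat w i.

Let kern_ge0 w x i : 0 <= kern w x i.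
Proof. exact: pihat_ge0. Qed.

Let erun_ge0 w A y n x : (0 <= (run (kern w) A (fun u => (u == y)%:R) n x)%:E)%E.
Proof. by rewrite lee_fin run_ge0. Qed.

(** In the environment shifted by [j] this is the mean number of visits to 0 made from [j] before
    level [j] is exceeded. *)
Definition ladder_visits (j : nat) w : \bar R :=
  (\sum_(0 <= k <oo)
    (run (kern w) (fun u : int => u <= 0) (fun u => (u == - j%:Z)%:R) k 0)%:E)%E.

(* By the ladder decomposition this bounds the Green function at 0 of every
   starting point, and by stationarity its mean is at most that of [t_1]. *)
Definition green_bound w : \bar R :=
  (\sum_(0 <= j <oo) ladder_visits j (envshift j%:Z w))%E.

Lemma ladder_visits_ge0 j w : (0 <= ladder_visits j w)%E.
Proof. by apply: nneseries_ge0 => k _ _. Qed.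

Lemma green_bound_ge0 w : (0 <= green_bound w)%E.
Proof. by apply: nneseries_ge0 => j _ _; exact: ladder_visits_ge0. Qed.

(** At each time before the passage above 0 the chain occupies at most one of the sites [- j]. *)
Lemma sum_ladder_visits_le w :
  (\sum_(0 <= j <oo) ladder_visits j w <= quenched_Et1 pihat w)%E.
Proof.
rewrite quenched_Et1E /ladder_visits nneseries_interchange //.
apply: lee_nneseries => [k _ _|k _]; first by apply: nneseries_ge0.
apply: lime_le; first by apply: is_cvg_nneseries.
apply: nearW => m; rewrite sumEFin lee_fin big_mkord.
rewrite [leLHS](_ : _ = run (kern w) (fun u : int => u <= 0)
  (fun u => \sum_(j < m) 1 * (u == - j%:Z)%:R) k 0); last first.
  by rewrite run_sum; apply: eq_bigr => j _; rewrite mul1r.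
apply: run_le => // x /=.
have [/existsP[j xj]|/existsPn nj] := boolP [exists j : 'I_m, x == - (j : nat)%:Z].
  rewrite (bigD1 j) //= xj mulr1 big1 ?addr0 // => i ij.
  case: eqP => [xi|_]; last by rewrite mulr0.
  case/negP: ij; apply/eqP/val_inj => /=; move/eqP: xj; lia.
by rewrite big1 // => i _; rewrite (negbTE (nj i)) mulr0.
Qed.

(** Translation brings each level [j] of the ladder sum to 0; letting the horizon and the number of
    levels grow removes the dependence on [n] and [x]. *)
Lemma visits_le_green_bound w n x :
  (forall y, \sum_(i < B.*2) kern w y i = 1) ->
  ((visits (kern w) predT 0%R n x)%:E <= green_bound w)%E.
Proof.
move=> sum1.
have [m hm] := visits_le_ladder (kern_ge0 w) sum1 n x.
have le1 : ((visits (kern w) predT 0%R n x)%:E <=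
    \sum_(0 <= j < m) ladder_visits j (envshift j%:Z w))%E.
  apply: (@le_trans _ _ (\sum_(j < m)
      visits (kern w) (fun u : int => u <= j%:Z) 0 n j%:Z)%:E).
    by rewrite lee_fin.
  rewrite big_mkord -sumEFin; apply: lee_sum => j _.
  rewrite /ladder_visits.
  have -> : visits (kern w) (fun u : int => u <= j%:Z) 0 n j%:Z =
      visits (kern (envshift j%:Z w)) (fun u : int => u <= 0) (- j%:Z) n 0.
    rewrite visits_kern_shift addNr add0r; congr visits.
    by apply: funext => u; rewrite subr_le0.
  by rewrite -sum_run_visits; apply: nneseries_lim_ge => k _ _.
apply: le_trans le1 _; apply: nneseries_lim_ge => j _ _.
exact: ladder_visits_ge0.
Qed.

(** A finite mean exit time is a convergent series of tail probabilities, whose terms vanish. *)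
Lemma exit_run_cvg0 w (y : int) :
  (quenched_Et1 pihat (envshift y w) < +oo)%E ->
  run (kern w) (fun u : int => u <= y) (cst 1) n y @[n --> \oo] --> (0 : R).
Proof.
rewrite quenched_Et1E => fin.
pose a n := run (kern w) (fun u : int => u <= y) (cst 1) n y.
have aE n : run (kern (envshift y w)) (fun u : int => u <= 0) (cst 1) n 0 = a n.
  rewrite run_kern_shift add0r /a; congr run.
  by apply: funext => u; rewrite subr_le0.
have a0 n : 0 <= a n by apply: run_ge0 => // u; exact: ler01.
move: fin; under eq_eseriesr do rewrite aE; move=> fin.
apply: (@cvg_series_cvg_0 _ R^o); apply: nondecreasing_is_cvgn.
  by apply: nondecreasing_series => n _ _; exact: a0.
exists (fine (\sum_(0 <= n <oo) (a n)%:E)%E) => _ [n _ <-].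
rewrite -lee_fin fineK; last first.
  by rewrite ge0_fin_numE // nneseries_ge0 // => k _ _; rewrite lee_fin.
rewrite /series /= -sumEFin; apply: nneseries_lim_ge => k _ _.
by rewrite lee_fin a0.
Qed.

(** * Measurability in the environment *)

Hypothesis mpihat : forall i, measurable_fun setT (fun w => pihat w i).

Lemma measurable_run A f n x :
  measurable_fun setT (fun w => run (kern w) A f n x).
Proof.
elim: n x => [|n IH] x /=; case: (A x) => //.
apply: measurable_sum => i.
apply: (@measurable_funM _ _ _ setT (fun w => kern w x i)) => //.
apply: (measurableT_comp (mpihat i)); exact: measurable_envshift.
Qed.

Lemma measurable_erun_series A f x : (forall u, 0 <= f u) ->
  measurable_fun setT (fun w =>
    \sum_(0 <= k <oo) (run (kern w) A f k x)%:E)%E.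
Proof.
move=> f0; apply: (ge0_emeasurable_sum (P := xpredT)).
  by move=> k w _ _; rewrite lee_fin run_ge0.
by move=> k _; apply/measurable_EFinP; exact: measurable_run.
Qed.

Lemma measurable_green x y : measurable_fun setT (fun w => green pihat w x y).
Proof.
under eq_fun do rewrite greenE.
exact: measurable_erun_series.
Qed.

Lemma measurable_quenched_Et1 : measurable_fun setT (quenched_Et1 pihat).
Proof.
rewrite (_ : quenched_Et1 pihat = fun w => quenched_Et1 pihat w) //.
under eq_fun do rewrite quenched_Et1E.
by apply: measurable_erun_series => u; exact: ler01.
Qed.

Lemma measurable_ladder_visits j : measurable_fun setT (ladder_visits j).
Proof. exact: measurable_erun_series. Qed.

Let measurable_ladder_shift (j : nat) :
  measurable_fun setT (fun w => ladder_visits j (envshift j%:Z w)).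
Proof.
apply: (measurableT_comp (measurable_ladder_visits j)).
exact: measurable_envshift.
Qed.

Lemma measurable_green_bound : measurable_fun setT green_bound.
Proof.
apply: (ge0_emeasurable_sum (P := xpredT)) => [j w _ _|j _].
  exact: ladder_visits_ge0.
exact: measurable_ladder_shift.
Qed.

(** * Consequences of stationarity *)

Variable P : probability (Omega R B) R.
Hypothesis P_stat : stationary P.

(** Every shift preserves null sets and there are countably many shifts, so facts at the origin hold
    at all sites off one null set. *)
Lemma ae_envshift (Q : Omega R B -> Prop) :
  {ae P, forall w, Q w} -> {ae P, forall w, forall z : int, Q (envshift z w)}.
Proof.
move=> aeQ.
have hQ z : {ae P, forall w, Q (envshift z w)}.
  by apply: ae_preimage aeQ; [exact: measurable_envshift|exact: P_stat].
have := ae_foralln (fun n : nat => hQ n%:Z).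
have := ae_foralln (fun n : nat => hQ (- n%:Z)).
apply: filterS2 => w hneg hpos z.
have [z0|z0] := leP 0 z.
  by have -> : z = `|z|%N%:Z by lia.
by have -> : z = - (`|z|%N%:Z) by lia.
Qed.

Lemma integral_green_bound :
  (\int[P]_w green_bound w <= \int[P]_w quenched_Et1 pihat w)%E.
Proof.
rewrite integral_nneseries //; last by move=> j w _; exact: ladder_visits_ge0.
under eq_eseriesr => j _.
  rewrite (@ge0_integral_preserving _ _ _ P (envshift j%:Z) (ladder_visits j));
    [|exact: measurable_envshift|exact: P_stat
     |exact: measurable_ladder_visits|exact: ladder_visits_ge0].
  over.
rewrite -integral_nneseries //; last 2 first.
- by move=> j; exact: measurable_ladder_visits.
- by move=> j w _; exact: ladder_visits_ge0.
apply: ge0_le_integral => //.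
- by move=> w _; apply: nneseries_ge0 => j _ _; exact: ladder_visits_ge0.
- apply: (ge0_emeasurable_sum (P := xpredT)) => [j w _ _|j _].
    exact: ladder_visits_ge0.
  exact: measurable_ladder_visits.
- exact: measurable_quenched_Et1.
- by move=> w _; exact: sum_ladder_visits_le.
Qed.

Lemma ae_fin_integral (g : Omega R B -> \bar R) :
  measurable_fun setT g -> (forall w, 0 <= g w)%E ->
  (\int[P]_w g w < +oo)%E -> {ae P, forall w, (g w < +oo)%E}.
Proof.
move=> mg g0 gfin.
have ig : P.-integrable setT g.
  apply/integrableP; split => //.
  by under eq_integral => w _ do rewrite gee0_abs //.
apply: filterS (integrable_ae measurableT ig) => w /(_ I).
by rewrite ge0_fin_numE.
Qed.

(** The threshold [e] depends on the environment, so recurrence is applied to each of the countably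
    many sets [good k]; using the shift by -1 places the returns towards the left. *)
Lemma ae_good_sites (hB : (0 < B)%N) :
  {ae P, forall w, 0 < pihat w (step_one hB)} ->
  {ae P, forall w, exists2 e : R, 0 < e &
    forall N : nat, exists2 y : int, y <= - N%:Z &
      forall x : int, y <= x < y + B%:Z -> e <= kern w x (step_one hB)}.
Proof.
move=> hpos.
pose good k : set (Omega R B) := \bigcap_(j in `I_B)
  [set w | k.+1%:R^-1 <= pihat (envshift j%:Z w) (step_one hB)].
have mgood k : measurable (good k).
  apply: bigcap_measurable; first by exists 0%N.
  move=> j _.
  have mj : measurable_fun setT
      (fun w : Omega R B => pihat (envshift j%:Z w) (step_one hB)).
    by apply: (measurableT_comp (mpihat _)); exact: measurable_envshift.
  have := mj measurableT `[k.+1%:R^-1, +oo[%classic (measurable_itv _).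
  rewrite setTI; congr (measurable _); apply/funext => w /=.
  by rewrite in_itv /= andbT.
have ms : measurable_fun setT (@envshift R B (-1)).
  exact: measurable_envshift.
have rec k := poincare_recurrence ms (P_stat (-1)) (mgood k).
have := ae_foralln rec; have := ae_envshift hpos.
apply: filterS2 => w wpos wrec.
(* Finitely many positive numbers have a positive minimum, which exceeds some [k.+1%:R^-1]. *)
have [k wk] : exists k, good k w.
  suff /(_ B)[e e0 he] : forall b, exists2 e : R, 0 < e & forall j, (j < b)%N ->
      e <= pihat (envshift j%:Z w) (step_one hB).
    exists (Num.bound e^-1) => j jB /=; apply: le_trans (he j jB).
    rewrite -[leRHS]invrK lef_pV2 ?posrE ?invr_gt0 ?ltr0n //.
    have : e^-1 < (Num.bound e^-1)%:R by apply: archi_boundP; rewrite invr_ge0 ltW.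
    by move=> /ltW /le_trans -> //; rewrite ler_nat.
  elim=> [|b [e e0 he]]; first by exists 1.
  exists (Num.min e (pihat (envshift b%:Z w) (step_one hB))).
    by rewrite lt_min e0 wpos.
  move=> j; rewrite ltnS leq_eqVlt => /orP[/eqP ->|jb]; rewrite ge_min ?lexx ?orbT //.
  by rewrite he.
exists k.+1%:R^-1; first by rewrite invr_gt0 ltr0n.
move=> N; have [n Nn] := wrec k wk N.
rewrite iter_envshift => gn; exists (- n%:Z); first by lia.
move=> x hx; have jB : (`|(x + n%:Z)%R|%N < B)%N by lia.
have /= := gn _ jB; rewrite envshift_comp /kern.
by have -> : `|(x + n%:Z)%R|%N%:Z - n%:Z = x by lia.
Qed.

End Environment.

(** * The limit of the Green function *)

Lemma cvg_int_shift (R : realType) (g : int -> R) (l : R) (z : int) :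
  g (- n%:Z) @[n --> \oo] --> l -> g (- n%:Z - z) @[n --> \oo] --> l.
Proof.
move=> /cvgrPdist_lt gl; apply/cvgrPdist_lt => e e0.
have [N _ gN] := gl e e0; exists (N + `|z|)%N => // n /= hn.
have -> : - n%:Z - z = - (`|(n%:Z + z)%R|%N)%:Z by lia.
by apply: gN => /=; lia.
Qed.

Section GreenLimit.
Variables (R : realType) (B : nat) (hB : (0 < B)%N).
Variable pihat : Omega R B -> step B -> R.
Hypothesis pihat_ge0 : forall w i, 0 <= pihat w i.

Let kern_ge0 w x i : 0 <= kern pihat w x i.
Proof. exact: pihat_ge0. Qed.

Lemma greenE_lim (w : Omega R B) (x y : int) :
  cvgn (fun n => visits (kern pihat w) predT y n x) ->
  green pihat w x y = (limn (fun n => visits (kern pihat w) predT y n x))%:E.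
Proof.
move=> cv; rewrite greenE -EFin_lim //; congr (limn _).
by apply: funext => n; rewrite sum_run_visits.
Qed.

Lemma visits_target_shift (w : Omega R B) (z x : int) n :
  visits (kern pihat w) predT z n x =
  visits (kern pihat (envshift z w)) predT 0 n (x - z).
Proof. by rewrite visits_kern_shift add0r subrK. Qed.

(** Stated with real limits of truncated visit counts, so that the decompositions pass to the limit
    in [R]. *)
Definition regular_env (w : Omega R B) (l : R) :=
  [/\ 0 < l, forall x, cvgn (fun n => visits (kern pihat w) predT 0 n x) &
    limn (fun k => visits (kern pihat w) predT 0 k (- n%:Z)) @[n --> \oo] --> l].

Lemma regular_env_green (w : Omega R B) (l : R) : regular_env w l ->
  green pihat w (- n%:Z) 0 @[n --> \oo] --> l%:E.
Proof.
move=> [_ cv lim]; under eq_cvg do rewrite greenE_lim //.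
by apply: cvg_EFin lim; apply: nearW.
Qed.

(** The Green function with target [z] is, up to translation, the one with target 0 in the
    environment shifted by [z]; the last-step decomposition links the targets 0 and [- stepz i]. *)
Lemma invariance (w : Omega R B) (phi : Omega R B -> R) :
  (forall z, regular_env (envshift z w) (phi (envshift z w))) ->
  \sum_(i < B.*2) phi (envshift (- stepz i) w) *
    pihat (envshift (- stepz i) w) i = phi w.
Proof.
move=> reg.
pose g z x := limn (fun n => visits (kern pihat w) predT z n x).
have cv z x : cvgn (fun n => visits (kern pihat w) predT z n x).
  under eq_fun do rewrite visits_target_shift.
  by have [_ cz _] := reg z; exact: cz.
have gE z x : g z x =
    limn (fun n => visits (kern pihat (envshift z w)) predT 0 n (x - z)).
  by congr (limn _); apply: funext => n; rewrite visits_target_shift.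
have glim z : g z (- n%:Z) @[n --> \oo] --> phi (envshift z w).
  under eq_cvg do rewrite gE.
  have [_ _ lim] := reg z.
  exact: (@cvg_int_shift _ (fun x => limn (fun k =>
    visits (kern pihat (envshift z w)) predT 0 k x))).
have step x : g 0 x = (x == 0)%:R +
    \sum_(i < B.*2) kern pihat w (- stepz i) i * g (- stepz i) x.
  apply: (cvg_lim (@Rhausdorff R)).
  rewrite -(cvg_shiftS (fun n => visits (kern pihat w) predT 0 n x)) /=.
  have visE n : visits (kern pihat w) predT 0 n.+1 x = (x == 0)%:R +
      \sum_(i < B.*2) kern pihat w (- stepz i) i *
        visits (kern pihat w) predT (- stepz i) n x.
    rewrite /visits big_ord_recl; congr (_ + _).
    under eq_bigr => k _ do rewrite lift0 run_occupation_step.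
    rewrite exchange_big /=; apply: eq_bigr => i _.
    by rewrite mulr_sumr.
  under eq_cvg do rewrite visE.
  apply: cvgD; first exact: cvg_cst.
  by apply: cvg_sumr => i; apply: cvgMr; exact: cv.
(* Starting from [- n.+1] rather than [- n] removes the indicator of [x = 0]. *)
have glimS z : g z (- n.+1%:Z) @[n --> \oo] --> phi (envshift z w).
  by rewrite (cvg_shiftS (fun n : nat => g z (- n%:Z))); exact: glim.
have := glimS 0; rewrite envshift0 => /(cvg_lim (@Rhausdorff R)) <-.
symmetry; apply: (cvg_lim (@Rhausdorff R)).
under eq_cvg do rewrite step oppr_eq0 /= add0r.
by apply: cvg_sumr => i; rewrite mulrC; apply: cvgMr; exact: glimS.
Qed.

Lemma regular_env_exists (w : Omega R B) :
  (forall y, \sum_(i < B.*2) kern pihat w y i = 1) ->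
  (forall y, 0 < kern pihat w y (step_one hB)) ->
  (forall y, quenched_Et1 pihat (envshift y w) < +oo)%E ->
  (green_bound pihat w < +oo)%E ->
  (exists2 e : R, 0 < e &
    forall N : nat, exists2 y : int, y <= - N%:Z &
      forall x : int, y <= x < y + B%:Z -> e <= kern pihat w x (step_one hB)) ->
  exists2 l, regular_env w l & (l%:E <= green_bound pihat w)%E.
Proof.
move=> sum1 one_gt0 Et1_fin bound_fin [e e0 good].
have bnd n x : visits (kern pihat w) predT 0 n x <= fine (green_bound pihat w).
  rewrite -lee_fin fineK ?visits_le_green_bound //.
  by rewrite ge0_fin_numE // green_bound_ge0.
have exit y := exit_run_cvg0 pihat_ge0 (Et1_fin y).
have [l l0 lim] := green_limit_gt0 (kern_ge0 w) sum1 exit e0 good one_gt0 bnd.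
have reg : regular_env w l.
  by split=> // x; exact: (visits_cvg (kern_ge0 w) bnd).
exists l => //.
rewrite -(cvg_lim (@ereal_hausdorff R) (regular_env_green reg)).
apply: lime_le; first by apply/cvg_ex; exists l%:E; exact: regular_env_green.
apply: nearW => n; rewrite greenE.
apply: lime_le; first by apply: is_cvg_nneseries => k _ _; rewrite lee_fin run_ge0.
by apply: nearW => m; rewrite sum_run_visits visits_le_green_bound.
Qed.

End GreenLimit.

(** * Assembly on one almost sure event *)

Theorem theorem1p9 (R : realType) (B : nat) (hB : (0 < B)%N)
    (P : probability (Omega R B) R)
    (P_env : {ae P, forall w, is_env w})
    (P_stat : stationary P) (P_erg : ergodic P)
    (pihat : Omega R B -> step B -> R)
    (hker : env_kernel P pihat)
    (hpos : {ae P, forall w, 0 < pihat w (step_one hB)})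
    (hEt1 : (\int[P]_w quenched_Et1 pihat w < +oo)%E) :
  exists phi : Omega R B -> R,
    [/\ {ae P, forall w,
           (green pihat w (- (n%:Z)) 0 @[n --> \oo] --> (phi w)%:E) /\ 0 < phi w},
        P.-integrable setT (EFin \o phi) &
        {ae P, forall w,
           \sum_(i : step B) phi (envshift (- stepz i) w) * pihat (envshift (- stepz i) w) i
           = phi w}].
Proof.
have [mpihat pihat_ge0 sum1] := hker.
(* The upper limit is defined and measurable everywhere; it is the limit wherever that exists. *)
pose phi w := fine (limn_esup (fun n : nat => green pihat w (- n%:Z) 0)).
have mphi : measurable_fun setT (EFin \o phi).
  apply/measurable_EFinP; apply: measurableT_comp => //.
  by apply: measurable_fun_limn_esup => n; exact: measurable_green.
have mbound := measurable_green_bound pihat_ge0 mpihat.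
have bound_ge0 := green_bound_ge0 pihat_ge0.
have bound_int : (\int[P]_w green_bound pihat w < +oo)%E.
  exact: le_lt_trans (integral_green_bound pihat_ge0 mpihat P_stat) hEt1.
have Et1_ge0 w : (0 <= quenched_Et1 pihat w)%E.
  rewrite quenched_Et1E; apply: nneseries_ge0 => k _ _.
  by rewrite lee_fin; apply: run_ge0 => [x i|u]; [exact: pihat_ge0|exact: ler01].
have Et1_fin : {ae P, forall w, (quenched_Et1 pihat w < +oo)%E}.
  by apply: ae_fin_integral => //; exact: measurable_quenched_Et1.
have bound_fin := ae_fin_integral mbound bound_ge0 bound_int.
have sites := ae_good_sites mpihat P_stat hpos.
have reg : {ae P, forall w,
    regular_env pihat w (phi w) /\ ((phi w)%:E <= green_bound pihat w)%E}.
  apply: filterS (filterI (filterI bound_fin sites) (filterI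
    (ae_envshift P_stat sum1) (filterI (ae_envshift P_stat hpos)
    (ae_envshift P_stat Et1_fin)))) => w [[bw sw] [sumw [pw ew]]].
  have [l rl lb] := regular_env_exists pihat_ge0 sumw pw ew bw sw.
  suff -> : phi w = l by [].
  by rewrite /phi (cvg_limn_einf_sup (regular_env_green rl)).2.
exists phi; split.
- apply: filterS reg => w [rw _]; split; first exact: regular_env_green.
  by case: rw.
- apply/integrableP; split => //; apply: le_lt_trans bound_int.
  apply: ae_ge0_le_integral => //; first exact: measurableT_comp.
  apply: filterS reg => w [[l0 _ _] lb] _ /=.
  by rewrite ger0_norm // ltW.
(* Invariance compares [phi] at several shifts, so regularity is needed at all of them
   simultaneously. *)
- have := ae_envshift P_stat reg; apply: filterS => w rw.
  by apply: invariance => z; have [] := rw z.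
Qed.
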